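(* Let $n\geq 4$. There exist two convex bodies $K,L\subset\mathbb{R}^n$ such that $K\neq L$ and $K\neq -L$, but nevertheless for every $\xi\in S^{n-1}$ there is a rotation $\phi_\xi\in SO(n-1)$ in $\xi^\perp$ satisfying $\phi_\xi(K\cap\xi^\perp)=L\cap\xi^\perp$.
   Context: A convex body in $\mathbb{R}^n$ is a compact set with non-empty interior such that the segment joining every pair of its points is contained in it. $S^{n-1}$ is the unit sphere of $\mathbb{R}^n$, and for $\xi\in S^{n-1}$, $\xi^\perp=\{x\in\mathbb{R}^n:\langle x,\xi\rangle=0\}$ is the hyperplane through the origin perpendicular to $\xi$. ''$\phi_\xi\in SO(n-1)$ in $\xi^\perp$'' means that $\phi_\xi$ is a linear orthogonal transformation of determinant $1$ of the $(n-1)$-dimensional Euclidean space $\xi^\perp$ onto itself. $-L=\{-x:x\in L\}$. *)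

(* Defs.v *)
From mathcomp Require Import all_boot all_order all_algebra.
From mathcomp Require Import all_classical all_reals all_analysis.

Set Implicit Arguments.
Unset Strict Implicit.
Unset Printing Implicit Defensive.

Import Order.TTheory GRing.Theory Num.Theory.
Import numFieldNormedType.Exports.

Local Open Scope classical_set_scope.
Local Open Scope ring_scope.

(* The library's norm on 'rV[R]_n is the sup norm.  It induces the Euclidean
   topology, so it can serve for [compact] and [interior], but lengths and
   angles have to be expressed with [dotp]. *)
Definition convex_body (R : realType) (n : nat) (K : set 'rV[R]_n) : Prop :=
  [/\ compact K, interior K !=set0 & convex_set K].

Definition dotp (R : realType) (n : nat) (x y : 'rV[R]_n) : R :=
  \sum_(i < n) x 0 i * y 0 i.

Definition unit_sphere (R : realType) (n : nat) : set 'rV[R]_n :=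
  [set x | dotp x x = 1].

(* The kernel of the linear form x |-> <x, xi>; see [mem_perp]. *)
Definition perp (R : realType) (n : nat) (xi : 'rV[R]_n) : {vspace 'rV[R]_n} :=
  lker (linfun (mulmxr xi^T : 'rV[R]_n -> 'rV[R]_1)).

Lemma mem_perp (R : realType) (n : nat) (xi x : 'rV[R]_n) :
  (x \in perp xi) = (dotp x xi == 0).
Proof.
have e : (x *m xi^T) 0 0 = dotp x xi.
  by rewrite mxE; apply: eq_bigr => i _; rewrite mxE.
rewrite memv_ker lfunE /= -e; apply/eqP/eqP => [->|e0]; first by rewrite mxE.
by apply/matrixP => i j; rewrite !ord1 e0 mxE.
Qed.

Lemma dim_perp (R : realType) (n : nat) (xi : 'rV[R]_n) :
  unit_sphere xi -> \dim (perp xi) = n.-1.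
Proof.
move=> xi1.
have := limg_ker_dim (linfun (mulmxr xi^T : 'rV[R]_n -> 'rV[R]_1)) fullv.
rewrite capfv -/(perp xi) !dimvf.
suff -> : limg (linfun (mulmxr xi^T : 'rV[R]_n -> 'rV[R]_1)) = fullv.
  by rewrite dimvf !dim_matrix !mul1r addn1 => /(congr1 predn).
apply/eqP; rewrite eqEsubv subvf; apply/subvP => y _.
apply/memv_imgP; exists (y 0 0 *: xi); first exact: memvf.
rewrite lfunE /=; apply/matrixP => i j; rewrite !ord1 mxE.
rewrite -[LHS]mulr1 -xi1 mulr_sumr.
by apply: eq_bigr => k _; rewrite !mxE mulrA.
Qed.

(* The library has no determinant of an endomorphism; it is computed here in
   an arbitrary basis, which is immaterial by [lfun_detE]. *)
Definition lfun_det (F : fieldType) (V : vectType F) (f : 'End(V)) : F :=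
  \det (passmx.mxof (vbasis {:V}) (vbasis {:V}) f).

Lemma lfun_detE (F : fieldType) (V : vectType F) (e : (\dim {:V}).-tuple V)
    (f : 'End(V)) :
  basis_of {:V} e -> lfun_det f = \det (passmx.mxof e e f).
Proof.
move=> eb; have bb := vbasisP {:V}.
set b := vbasis {:V} in bb *.
have PQ : passmx.mxof b e \1 *m passmx.mxof e b \1 = 1%:M.
  by rewrite -passmx.mxof_comp // comp_lfun1l passmx.mxof1 // (basis_free bb).
have -> : lfun_det f =
    \det (passmx.mxof b e \1 *m passmx.mxof e e f *m passmx.mxof e b \1).
  by rewrite -!passmx.mxof_comp // comp_lfun1l comp_lfun1r.
by rewrite !det_mulmx mulrAC -det_mulmx PQ det1 mul1r.
Qed.

(* f belongs to SO(U), for a subspace U with the induced inner product. *)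
Definition rotation (R : realType) (n : nat) (U : {vspace 'rV[R]_n})
    (f : 'End(subvs_of U)) : Prop :=
  (forall x y : subvs_of U, dotp (vsval (f x)) (vsval (f y)) =
                            dotp (vsval x) (vsval y)) /\
  lfun_det f = 1.

(* Main.v *)
(* With [Q x = x_i ^+ 2 - x_j ^+ 2], cut the unit ball by one cap inside
   [Q > 0, x_i > 0] and by one cap inside [Q < 0, x_j > 0]; this gives [K], and
   moving only the second cap to [x_j < 0] gives [L].  The restriction of [Q] to
   a central hyperplane diagonalizes in an orthonormal basis, so reversing the
   basis vector [v] of negative eigenvalue preserves [Q]; it preserves the sign
   of [x_i] where [Q > 0] and reverses that of [x_j] where [Q < 0], hence it
   exchanges the sections of [K] and [L].  As the hyperplane has dimension at
   least 3, it contains a vector [c] orthogonal to [v] on which [x_i] and [x_j]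
   vanish, and reversing [c] as well makes the map a rotation. *)
Require Import Defs.
From HB Require Import structures.
From mathcomp Require Import all_boot all_order all_algebra.
From mathcomp Require Import all_classical all_reals all_analysis.
From mathcomp Require Import ring lra.
Import Order.TTheory GRing.Theory Num.Theory.
Import numFieldNormedType.Exports.
Local Open Scope classical_set_scope.
Local Open Scope ring_scope.

(** * The Euclidean inner product *)

Lemma dotpC {R : realType} {n : nat} (x y : 'rV[R]_n) : dotp x y = dotp y x.
Proof. by apply: eq_bigr => k _; rewrite mulrC. Qed.

Lemma dotpDl {R : realType} {n : nat} (x y z : 'rV[R]_n) :
  dotp (x + y) z = dotp x z + dotp y z.
Proof. by rewrite -big_split; apply: eq_bigr => k _; rewrite mxE mulrDl. Qed.

Lemma dotpZl {R : realType} {n : nat} (a : R) (x z : 'rV[R]_n) :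
  dotp (a *: x) z = a * dotp x z.
Proof. by rewrite mulr_sumr; apply: eq_bigr => k _; rewrite mxE mulrA. Qed.

Lemma dotpNl {R : realType} {n : nat} (x z : 'rV[R]_n) :
  dotp (- x) z = - dotp x z.
Proof. by rewrite -scaleN1r dotpZl mulN1r. Qed.

Lemma dotpDr {R : realType} {n : nat} (x y z : 'rV[R]_n) :
  dotp z (x + y) = dotp z x + dotp z y.
Proof. by rewrite !(dotpC z) dotpDl. Qed.

Lemma dotpZr {R : realType} {n : nat} (a : R) (x z : 'rV[R]_n) :
  dotp z (a *: x) = a * dotp z x.
Proof. by rewrite !(dotpC z) dotpZl. Qed.

Lemma dotpNr {R : realType} {n : nat} (x z : 'rV[R]_n) :
  dotp z (- x) = - dotp z x.
Proof. by rewrite !(dotpC z) dotpNl. Qed.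

Definition dotpE := (@dotpDl, @dotpDr, @dotpNl, @dotpNr, @dotpZl, @dotpZr).

Lemma dotp_delta {R : realType} {n : nat} (x : 'rV[R]_n) (i : 'I_n) :
  dotp x (delta_mx 0 i) = x 0 i.
Proof.
rewrite /dotp (bigD1 i) //= big1 ?addr0; first by rewrite mxE !eqxx mulr1.
by move=> k ki; rewrite mxE (negbTE ki) andbF mulr0.
Qed.

Lemma dotp_deltal {R : realType} {n : nat} (x : 'rV[R]_n) (i : 'I_n) :
  dotp (delta_mx 0 i) x = x 0 i.
Proof. by rewrite dotpC dotp_delta. Qed.

Lemma dotp_ge0 {R : realType} {n : nat} (x : 'rV[R]_n) : 0 <= dotp x x.
Proof. by apply: sumr_ge0 => k _; rewrite -expr2 sqr_ge0. Qed.

Lemma sqr_coord_le {R : realType} {n : nat} (x : 'rV[R]_n) (i : 'I_n) :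
  x 0 i ^+ 2 <= dotp x x.
Proof.
rewrite /dotp (bigD1 i) //= expr2 lerDl.
by apply: sumr_ge0 => k _; rewrite -expr2 sqr_ge0.
Qed.

Lemma dotp_eq0 {R : realType} {n : nat} (x : 'rV[R]_n) : dotp x x = 0 -> x = 0.
Proof.
move=> x0; apply/matrixP => k i; rewrite ord1 mxE; apply/eqP.
by rewrite -sqrf_eq0 eq_le sqr_ge0 -x0 sqr_coord_le.
Qed.

Lemma normalize {R : realType} {n : nat} {x : 'rV[R]_n} : 0 < dotp x x ->
  exists2 t : R, 0 < t & dotp (t *: x) (t *: x) = 1.
Proof.
move=> x0; exists (Num.sqrt (dotp x x))^-1; first by rewrite invr_gt0 sqrtr_gt0.
have s0 : Num.sqrt (dotp x x) != 0 by rewrite gt_eqF // sqrtr_gt0.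
rewrite !dotpE -{3}[dotp x x]sqr_sqrtr ?ltW //.
by field.
Qed.

(** * Half turns in a plane and their determinant *)

(** For orthonormal [v], [c] this is the rotation taking [v] to [c] and [c] to [- v] and fixing all
    vectors orthogonal to both: a square root of [half_turn], from which the determinant of the
    latter is found. *)
Definition quarter_turn {R : realType} {n : nat} (v c x : 'rV[R]_n) : 'rV[R]_n :=
  x + (- dotp x v - dotp x c) *: v + (dotp x v - dotp x c) *: c.

Definition half_turn {R : realType} {n : nat} (v c x : 'rV[R]_n) : 'rV[R]_n :=
  x - (2 * dotp x v) *: v - (2 * dotp x c) *: c.

Lemma quarter_turn_is_linear {R : realType} {n : nat} (v c : 'rV[R]_n) :
  linear (quarter_turn v c).
Proof.
by move=> a x y; apply/matrixP => k l; rewrite /quarter_turn !(mxE, dotpE); ring.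
Qed.

HB.instance Definition _ (R : realType) (n : nat) (v c : 'rV[R]_n) :=
  GRing.isSemilinear.Build R 'rV[R]_n 'rV[R]_n _ (quarter_turn v c)
    (GRing.semilinear_linear (quarter_turn_is_linear v c)).

Lemma quarter_turn2 {R : realType} {n : nat} (v c x : 'rV[R]_n) :
  dotp v v = 1 -> dotp c c = 1 -> dotp v c = 0 ->
  quarter_turn v c (quarter_turn v c x) = half_turn v c x.
Proof.
move=> vv cc vc; have cv : dotp c v = 0 by rewrite dotpC.
apply/matrixP => k l; rewrite /quarter_turn /half_turn.
by rewrite !(mxE, dotpE) vv cc vc cv; ring.
Qed.

Lemma half_turnK {R : realType} {n : nat} (v c x : 'rV[R]_n) :
  dotp v v = 1 -> dotp c c = 1 -> dotp v c = 0 ->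
  half_turn v c (half_turn v c x) = x.
Proof.
move=> vv cc vc; have cv : dotp c v = 0 by rewrite dotpC.
apply/matrixP => k l; rewrite /half_turn.
by rewrite !(mxE, dotpE) vv cc vc cv; ring.
Qed.

Lemma dotp_half_turn {R : realType} {n : nat} (v c x y : 'rV[R]_n) :
  dotp v v = 1 -> dotp c c = 1 -> dotp v c = 0 ->
  dotp (half_turn v c x) (half_turn v c y) = dotp x y.
Proof.
move=> vv cc vc; have cv : dotp c v = 0 by rewrite dotpC.
rewrite /half_turn !dotpE vv cc vc cv (dotpC v y) (dotpC c y).
by ring.
Qed.

Lemma lfun_det_comp {F : fieldType} {V : vectType F} (f g : 'End(V)) :
  lfun_det (f \o g)%VF = lfun_det f * lfun_det g.
Proof.
rewrite /lfun_det (@passmx.mxof_comp _ _ _ _ _ (vbasis {:V})) ?vbasisP //.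
by rewrite det_mulmx mulrC.
Qed.

Lemma lfun_det1 {F : fieldType} {V : vectType F} : lfun_det (\1%VF : 'End(V)) = 1.
Proof. by rewrite /lfun_det passmx.mxof1 ?det1 // (basis_free (vbasisP _)). Qed.

(* The determinant of a half turn [f \o f] is a square whose square is 1. *)
Lemma half_turn_rotation {R : realType} {n : nat} {U : {vspace 'rV[R]_n}}
    {v c : 'rV[R]_n} :
  v \in U -> c \in U -> dotp v v = 1 -> dotp c c = 1 -> dotp v c = 0 ->
  exists phi : 'End(subvs_of U),
    rotation phi /\ forall x, vsval (phi x) = half_turn v c (vsval x).
Proof.
move=> vU cU vv cc vc.
pose f : 'End(subvs_of U) :=
  linfun (vsproj U \o quarter_turn v c \o (vsval : subvs_of U -> 'rV[R]_n)).
have fE x : vsval (f x) = quarter_turn v c (vsval x).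
  by rewrite lfunE /= vsprojK // !memvD ?memvZ ?subvsP.
have ffE x : vsval ((f \o f)%VF x) = half_turn v c (vsval x).
  by rewrite comp_lfunE !fE quarter_turn2.
exists (f \o f)%VF; split => //; split.
  move=> x y; rewrite -(dotp_half_turn v c (vsval x) _ vv cc vc).
  by congr dotp; exact: ffE.
have ff1 : ((f \o f) \o (f \o f))%VF = \1%VF.
  apply/lfunP => x; apply: val_inj.
  rewrite comp_lfunE id_lfunE -[RHS](half_turnK v c _ vv cc vc).
  by apply: (etrans (ffE _)); congr half_turn; exact: ffE.
have := congr1 (@lfun_det _ _) ff1; rewrite lfun_det1 !lfun_det_comp => d1.
have : 0 <= lfun_det f * lfun_det f by rewrite -expr2 sqr_ge0.
move: d1; set d := lfun_det f * lfun_det f => d1 d0.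
have : (d - 1) * (d + 1) = 0 by ring: d1.
by move/eqP; rewrite mulf_eq0 subr_eq0 (gt_eqF (ltr_wpDl d0 ltr01)) orbF => /eqP.
Qed.

(** * The form [x_i ^+ 2 - x_j ^+ 2] on a central hyperplane *)

(** The hypothesis says that the part of [xi] outside the coordinates [i], [j] has length zero. *)
Lemma dotp_split2 {R : realType} {n : nat} {i j : 'I_n} (x : 'rV[R]_n)
    {xi : 'rV[R]_n} :
  i != j -> xi 0 i ^+ 2 + xi 0 j ^+ 2 = dotp xi xi ->
  dotp x xi = x 0 i * xi 0 i + x 0 j * xi 0 j.
Proof.
move=> ij e.
have : xi - xi 0 i *: delta_mx 0 i - xi 0 j *: delta_mx 0 j = 0.
  apply: dotp_eq0.
  rewrite !dotpE !dotp_delta !dotp_deltal !mxE !eqxx /= (negbTE ij).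
  by rewrite (eq_sym j) (negbTE ij) /= -e; ring.
move/eqP; rewrite -addrA -opprD subr_eq0 => /eqP {1}->.
by rewrite !dotpE !dotp_delta; ring.
Qed.

Lemma dotp_sqr2_le {R : realType} {n : nat} (i j : 'I_n) (xi : 'rV[R]_n) :
  i != j -> xi 0 i ^+ 2 + xi 0 j ^+ 2 <= dotp xi xi.
Proof.
move=> ij; rewrite -subr_ge0.
have := dotp_ge0 (xi - xi 0 i *: delta_mx 0 i - xi 0 j *: delta_mx 0 j).
rewrite !dotpE !dotp_delta !dotp_deltal !mxE !eqxx /= (negbTE ij).
rewrite (eq_sym j) (negbTE ij) /=.
by congr (_ <= _); ring.
Qed.

(** The roots of [r ^+ 2 - m * r - d] have product [- d] and sum [m], so the larger one is
    positive. *)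
Lemma quadratic_pos_root {R : realType} (m d : R) : 0 <= d -> 0 < m \/ 0 < d ->
  exists2 r : R, 0 < r & r ^+ 2 = m * r + d.
Proof.
move=> d0 md.
have D0 : 0 <= m ^+ 2 + 4 * d by rewrite addr_ge0 ?sqr_ge0 ?mulr_ge0.
have sE := sqr_sqrtr D0; have s0 := sqrtr_ge0 (m ^+ 2 + 4 * d).
exists ((m + Num.sqrt (m ^+ 2 + 4 * d)) / 2); last by field: sE.
move: s0 sE; set s := Num.sqrt _ => s0 sE.
by case: md => ?; nra.
Qed.

(* [v] spans the negative eigenline of [x_i ^+ 2 - x_j ^+ 2] restricted to the
   orthogonal complement of [xi]. *)
Lemma negative_eigenvector {R : realType} {n : nat} {i j : 'I_n}
    {xi : 'rV[R]_n} : i != j -> dotp xi xi = 1 ->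
  (forall x, dotp x xi = 0 -> x 0 j ^+ 2 <= x 0 i ^+ 2) \/
  exists v : 'rV[R]_n,
    [/\ dotp v v = 1, dotp v xi = 0, v 0 i ^+ 2 < v 0 j ^+ 2,
        forall z, dotp z xi = 0 -> dotp z v = 0 ->
          z 0 i * v 0 i = z 0 j * v 0 j &
        forall z : 'rV[R]_n, z 0 i = 0 -> z 0 j = 0 ->
          dotp z xi = 0 -> dotp z v = 0].
Proof.
move=> ij xi1; set p := xi 0 i; set q := xi 0 j.
have pq1 : p ^+ 2 + q ^+ 2 <= 1 by rewrite -xi1 dotp_sqr2_le.
have [pq|pq] := boolP ((0 < p ^+ 2 - q ^+ 2) || (0 < 1 - p ^+ 2 - q ^+ 2)).
- right.
  have [||mu mu0 muE] := @quadratic_pos_root R (p ^+ 2 - q ^+ 2)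
    (1 - p ^+ 2 - q ^+ 2); [lra|exact/orP|].
  (* Among the projections of [a e_i + b e_j] to the hyperplane, those in the
     eigenline of [- mu] satisfy [a (1 - p ^+ 2 + mu) = b p q], and [mu] is a
     root of the characteristic polynomial. *)
  pose a := p * q; pose b := mu + 1 - p ^+ 2.
  pose u : 'rV[R]_n := a *: delta_mx 0 i + b *: delta_mx 0 j - (a * p + b * q) *: xi.
  have ui : u 0 i = - mu * a.
    by rewrite !mxE !eqxx (negbTE ij) -/p -/q /= /a /b; ring.
  have uj : u 0 j = mu * b.
    rewrite !mxE !eqxx (eq_sym j) (negbTE ij) -/p -/q /=.
    rewrite (_ : mu * b = mu ^+ 2 + mu * (1 - p ^+ 2)); last by rewrite /b; ring.
    by rewrite muE /a /b; ring.
  have zu z : dotp z xi = 0 -> dotp z u = a * z 0 i + b * z 0 j.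
    by move=> zxi; rewrite !dotpE zxi !dotp_delta; ring.
  have uxi : dotp u xi = 0.
    by rewrite !dotpE !dotp_deltal xi1 -/p -/q; ring.
  have uu : dotp u u = mu * (b ^+ 2 - a ^+ 2).
    by rewrite zu // ui uj; ring.
  have b0 : 0 < b by rewrite /b; have := sqr_ge0 q; nra.
  have uu0 : 0 < dotp u u.
    apply: lt_le_trans (sqr_coord_le u j).
    by rewrite uj exprn_gt0 // mulr_gt0.
  have ab : a ^+ 2 < b ^+ 2 by move: uu0; rewrite uu pmulr_rgt0 // subr_gt0.
  have [t t0 tu1] := normalize uu0.
  have tuE k : (t *: u) 0 k = t * u 0 k by rewrite mxE.
  exists (t *: u); split => //.
  + by rewrite dotpZl uxi mulr0.
  + rewrite -subr_gt0 !tuE ui uj.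
    rewrite (_ : _ - _ = (t * mu) ^+ 2 * (b ^+ 2 - a ^+ 2)); last by ring.
    by rewrite mulr_gt0 ?exprn_gt0 ?mulr_gt0 ?subr_gt0.
  (* Up to the factor [- (t * mu)], the polar form of [x_i ^+ 2 - x_j ^+ 2] at [z] and [t *: u] is
     [dotp z u]. *)
  + move=> z zxi /eqP; rewrite dotpZr mulf_eq0 (gt_eqF t0) /= zu // => /eqP e.
    apply/eqP; rewrite -subr_eq0 !tuE ui uj; apply/eqP.
    rewrite (_ : _ - _ = - (t * mu) * (a * z 0 i + b * z 0 j)); last by ring.
    by rewrite e mulr0.
  + by move=> z zi zj zxi; rewrite dotpZr zu // zi zj !mulr0 addr0 mulr0.
(* Here [p ^+ 2 + q ^+ 2 = 1] and [p ^+ 2 <= q ^+ 2]: [xi] lies in the plane of the coordinates [i],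
   [j], and the hyperplane has the equation [x_i p = - x_j q]. *)
- left=> x; move: pq; rewrite negb_or -!leNgt => /andP[pq pq'].
  rewrite (dotp_split2 x ij) -/p -/q; last by rewrite xi1 -/p -/q; lra.
  move=> /eqP; rewrite addr_eq0 => /eqP/(congr1 (fun r => r ^+ 2)).
  rewrite sqrrN !exprMn => e.
  have q0 : 0 < q ^+ 2 by lra.
  rewrite -(ler_pM2r q0) -e ler_wpM2l ?sqr_ge0 //.
  by lra.
Qed.

(** The two coordinates [k], [l] leave room for a vector orthogonal to [xi]: normalize [w], or take
    [e_k] when [w = 0], since then [xi 0 k = 0]. *)
Lemma orthogonal_unit_vector {R : realType} {n : nat} {i j k l : 'I_n}
    (xi : 'rV[R]_n) : uniq [:: i; j; k; l] ->
  exists c : 'rV[R]_n, [/\ dotp c c = 1, dotp c xi = 0, c 0 i = 0 & c 0 j = 0].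
Proof.
rewrite /= !inE !negb_or => /and4P[/and3P[_ ik il] /andP[jk jl] kl _].
pose w : 'rV[R]_n := xi 0 l *: delta_mx 0 k - xi 0 k *: delta_mx 0 l.
have wxi : dotp w xi = 0 by rewrite !dotpE !dotp_deltal; ring.
have wi : w 0 i = 0 by rewrite !mxE (negbTE ik) (negbTE il) /=; ring.
have wj : w 0 j = 0 by rewrite !mxE (negbTE jk) (negbTE jl) /=; ring.
have [ww0|] := ltP 0 (dotp w w).
  have [t t0 tw] := normalize ww0; exists (t *: w).
  split => //; first by rewrite dotpZl wxi mulr0.
    by rewrite mxE wi mulr0.
  by rewrite mxE wj mulr0.
move=> ww; have : dotp w w = 0 by apply/eqP; rewrite eq_le ww dotp_ge0.
move=> /dotp_eq0/matrixP/(_ 0 l).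
rewrite !mxE !eqxx (eq_sym l) (negbTE kl) /= mulr0 mulr1 sub0r.
move=> /eqP; rewrite oppr_eq0 => /eqP xik.
exists (delta_mx 0 k); rewrite !dotp_deltal !mxE !eqxx.
by rewrite (negbTE ik) (negbTE jk) xik /=; split.
Qed.

(* [A, C] are the [x_i, x_j] coordinates of the component fixed by the half turn
   and [B, D] those of the reversed component along [v]. *)
Lemma half_turn_signs {R : realType} (A B C D : R) :
  A * B = C * D -> B ^+ 2 <= D ^+ 2 -> C ^+ 2 <= A ^+ 2 ->
  (0 < (A + B) ^+ 2 - (C + D) ^+ 2 -> 0 < (A + B) * (A - B)) /\
  ((A + B) ^+ 2 - (C + D) ^+ 2 < 0 -> (C + D) * (C - D) < 0).
Proof.
move=> e; have : A ^+ 2 * B ^+ 2 = C ^+ 2 * D ^+ 2 by rewrite -!exprMn e.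
have -> : (A + B) ^+ 2 - (C + D) ^+ 2 = A ^+ 2 + B ^+ 2 - (C ^+ 2 + D ^+ 2).
  by rewrite !sqrrD e; ring.
rewrite -[(A + B) * _]mulrC -[(C + D) * _]mulrC -!subr_sqr !subr_gt0 !subr_lt0.
move: (sqr_ge0 A) (sqr_ge0 B) (sqr_ge0 C) (sqr_ge0 D).
set a := A ^+ 2; set b := B ^+ 2; set c := C ^+ 2; set d := D ^+ 2.
move=> a0 b0 c0 d0 ab bd ca; split => h; rewrite ltNge; apply/negP => h'.
- have : 0 <= d * (d + c - a - b).
    have -> : d * (d + c - a - b) = (d - a) * (d - b) by ring: ab.
    by apply: mulr_ge0; lra.
  by nra.
- have : 0 <= a * (a + b - c - d).
    have -> : a * (a + b - c - d) = (a - c) * (a - d) by ring: ab.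
    by apply: mulr_ge0; lra.
  by nra.
Qed.

(** * The cut balls are convex bodies *)

Lemma dotp_continuous {R : realType} {n : nat} :
  continuous (fun x : 'rV[R]_n => dotp x x).
Proof.
rewrite /dotp; elim: (index_enum _) => [|k r IH].
  under eq_fun do rewrite big_nil.
  exact: cst_continuous.
under eq_fun do rewrite big_cons.
move=> x; apply: cvgD (IH x).
by apply: cvgM; exact: coord_continuous.
Qed.

(* [3 |x|^2 + 2 Q x <= 4] holds in the unit ball unless [Q x > |x|^2 / 2]. The
   positive parts confine each cut to one side, and the coefficients
   [3 - 2 > 0] keep both quadratic expressions convex. *)
Definition cut_ball {R : realType} {n : nat} (i j : 'I_n) (s : R) :
    set 'rV[R]_n :=
  [set x | [/\ dotp x x <= 1,
    3 * dotp x x + 2 * (Num.max 0 (x 0 i) ^+ 2 - x 0 j ^+ 2) <= 4 &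
    3 * dotp x x + 2 * (Num.max 0 (s * x 0 j) ^+ 2 - x 0 i ^+ 2) <= 4]].

Lemma closed_le_fun {R : realType} {n : nat} (f : 'rV[R]_n -> R) (a : R) :
  continuous f -> closed [set x | f x <= a].
Proof. by move=> cf; exact: ((continuous_closedP f).1 cf _ (@closed_le R a)). Qed.

Lemma continuous_cut {R : realType} {T : topologicalType} (s : R)
    (f g h : T -> R) : continuous f -> continuous g -> continuous h ->
  continuous (fun x => 3 * f x + 2 * (Num.max 0 (s * g x) ^+ 2 - h x ^+ 2)).
Proof.
move=> cf cg ch x.
have cm : Num.max 0 (s * g y) @[y --> x] --> Num.max 0 (s * g x).
  apply: (@continuous_max R T (fun=> 0) (fun y => s * g y)).
    exact: cvg_cst.
  by apply: cvgM; [exact: cvg_cst|exact: cg].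
apply: cvgD; first by apply: cvgM; [exact: cvg_cst|exact: cf].
apply: cvgM; first exact: cvg_cst.
by apply: cvgB; apply: cvgM => //; exact: ch.
Qed.

Lemma cut_ball_compact {R : realType} {n : nat} (i j : 'I_n) (s : R) :
  compact (cut_ball i j s).
Proof.
apply: bounded_closed_compact.
  exists 1; split => // M M1 x [x1 _ _]; apply: le_trans (ltW M1).
  rewrite [leLHS]/Num.norm /= mx_normrE.
  apply/bigmax_leP; split => // -[a k] _ /=; rewrite ord1.
  rewrite -(ler_pXn2r (n := 2)) ?nnegrE // expr1n real_normK ?num_real //.
  exact: le_trans (sqr_coord_le x k) x1.
pose f (t : R) (k l : 'I_n) (x : 'rV[R]_n) :=
  3 * dotp x x + 2 * (Num.max 0 (t * x 0 l) ^+ 2 - x 0 k ^+ 2).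
have -> : cut_ball i j s = [set x | dotp x x <= 1] `&`
    ([set x | f 1 j i x <= 4] `&` [set x | f s i j x <= 4]).
  apply/seteqP; split => x /=; rewrite /cut_ball /f /= mul1r.
    by case.
  by case=> ? [].
apply: closedI; first exact: closed_le_fun dotp_continuous.
by apply: closedI; apply: closed_le_fun; apply: continuous_cut;
  [exact: dotp_continuous|exact: coord_continuous|exact: coord_continuous|
   exact: dotp_continuous|exact: coord_continuous|exact: coord_continuous].
Qed.

Lemma max0_sqr_le {R : realType} (a : R) : Num.max 0 a ^+ 2 <= a ^+ 2.
Proof. by case: (leP 0 a) => // a0; rewrite expr0n /= sqr_ge0. Qed.

Lemma cut_ball_interior {R : realType} {n : nat} (i j : 'I_n) (s : R) :
  s ^+ 2 = 1 -> interior (cut_ball i j s) !=set0.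
Proof.
(* Both cut expressions are at most [5 * dotp x x], hence the radius with square [4 / 5]. *)
move=> s1; exists 0; apply: (@filterS _ _ _ [set x | dotp x x < 4 / 5]).
  move=> x /= x45; have xi := sqr_coord_le x i; have xj := sqr_coord_le x j.
  have mi := max0_sqr_le (x 0 i); have := max0_sqr_le (s * x 0 j).
  rewrite exprMn s1 mul1r => mj.
  have := sqr_ge0 (x 0 i); have := sqr_ge0 (x 0 j).
  by split; lra.
apply: open_nbhs_nbhs; split.
  exact: ((continuousP _).1 (@dotp_continuous R n) _ (@open_lt R (4 / 5))).
by rewrite /= -(scale0r (0 : 'rV[R]_n)) dotpZl mul0r; lra.
Qed.

(** The positive part is convex and nonnegative, and squaring is increasing and convex on
    nonnegative numbers. *)
Lemma max0_sqr_convex {R : realType} (t a b : R) : 0 <= t <= 1 ->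
  Num.max 0 (t * a + (1 - t) * b) ^+ 2 <=
    t * Num.max 0 a ^+ 2 + (1 - t) * Num.max 0 b ^+ 2.
Proof.
move=> /andP[t0 t1].
have a0 : 0 <= Num.max 0 a by rewrite le_max lexx.
have b0 : 0 <= Num.max 0 b by rewrite le_max lexx.
have aa : a <= Num.max 0 a by rewrite le_max lexx orbT.
have bb : b <= Num.max 0 b by rewrite le_max lexx orbT.
move: a0 b0 aa bb; set a' := Num.max 0 a; set b' := Num.max 0 b => a0 b0 aa bb.
apply: (@le_trans _ _ ((t * a' + (1 - t) * b') ^+ 2)).
  have w0 : 0 <= t * a' + (1 - t) * b' by rewrite addr_ge0 ?mulr_ge0 ?subr_ge0.
  rewrite ler_pXn2r ?nnegrE ?le_max ?lexx // ge_max w0 /=.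
  by apply: lerD; apply: ler_wpM2l; rewrite ?subr_ge0.
rewrite -subr_ge0.
rewrite (_ : _ - _ = t * (1 - t) * (a' - b') ^+ 2); last by ring.
by apply: mulr_ge0 (sqr_ge0 _); rewrite mulr_ge0 ?subr_ge0.
Qed.

(** The convexity defect of [3 * dotp z z - 2 * z 0 i ^+ 2] is [t * (1 - t)] times its value at
    [x - y], which is nonnegative because a squared coordinate is at most the squared length. *)
Lemma cut_convex {R : realType} {n : nat} (i j : 'I_n) (s t : R)
    (x y : 'rV[R]_n) (f := fun z : 'rV[R]_n =>
      3 * dotp z z + 2 * (Num.max 0 (s * z 0 j) ^+ 2 - z 0 i ^+ 2)) :
  0 <= t <= 1 -> f (t *: x + (1 - t) *: y) <= t * f x + (1 - t) * f y.
Proof.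
move=> t01; rewrite /f.
have -> : s * (t *: x + (1 - t) *: y) 0 j =
    t * (s * x 0 j) + (1 - t) * (s * y 0 j) by rewrite !mxE; ring.
have := max0_sqr_convex t (s * x 0 j) (s * y 0 j) t01.
have : 0 <= t * (1 - t) * (3 * dotp (x - y) (x - y) - 2 * (x - y) 0 i ^+ 2).
  case/andP: t01 => t0 t1; rewrite !mulr_ge0 ?subr_ge0 //.
  have := sqr_coord_le (x - y) i; have := sqr_ge0 ((x - y) 0 i).
  by lra.
rewrite !dotpE (dotpC y x) !mxE.
set mx := Num.max 0 (s * x 0 j); set my := Num.max 0 (s * y 0 j).
set mz := Num.max 0 _ => dist_ge max_le.
by lra.
Qed.

Lemma dotp_convex {R : realType} {n : nat} (t : R) (x y : 'rV[R]_n) :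
  0 <= t <= 1 -> dotp (t *: x + (1 - t) *: y) (t *: x + (1 - t) *: y) <=
    t * dotp x x + (1 - t) * dotp y y.
Proof.
move=> /andP[t0 t1]; have := dotp_ge0 (x - y).
rewrite -subr_ge0 !dotpE (dotpC y x) => h.
have : 0 <= t * (1 - t) * (dotp x x - dotp x y - (dotp x y - dotp y y)).
  by rewrite !mulr_ge0 ?subr_ge0 //; lra.
by lra.
Qed.

Lemma cut_ball_convex {R : realType} {n : nat} (i j : 'I_n) (s : R) :
  convex_set (cut_ball i j s : set (convex_lmodType 'rV[R]_n)).
Proof.
move=> x y t; rewrite !inE => -[x0 x1 x2] [y0 y1 y2].
have t01 : 0 <= t%:num <= 1 by apply/andP; split.
(* The first cut is the second one with [i], [j] exchanged and [s = 1]. *)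
have := cut_convex j i 1 t%:num x y t01; rewrite !mul1r => h1.
have h2 := cut_convex i j s t%:num x y t01.
have h0 := dotp_convex t%:num x y t01.
have le4 (a b r : R) : a <= r -> b <= r -> t%:num * a + (1 - t%:num) * b <= r.
  by case/andP: t01; nra.
split.
- by apply: le_trans h0 _; exact: le4.
- by apply: le_trans h1 _; exact: le4.
- by apply: le_trans h2 _; exact: le4.
Qed.

Lemma cut_ball_convex_body {R : realType} {n : nat} (i j : 'I_n) (s : R) :
  s ^+ 2 = 1 -> convex_body (cut_ball i j s).
Proof.
by move=> s1; split; [exact: cut_ball_compact|exact: cut_ball_interior|
  exact: cut_ball_convex].
Qed.

(** * Exchanging the sections of the two bodies *)

(** A cut follows from the ball bound unless its form is positive and its positive part nonzero at
    [y]. In that case the sign hypotheses make the positive part nonzero at [x] as well, and the cut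
    at [x] is the same inequality. *)
Lemma cut_ball_transfer {R : realType} {n : nat} {i j : 'I_n} {s : R}
    {x y : 'rV[R]_n} : s ^+ 2 = 1 -> dotp y y = dotp x x ->
  y 0 i ^+ 2 - y 0 j ^+ 2 = x 0 i ^+ 2 - x 0 j ^+ 2 ->
  (0 < x 0 i ^+ 2 - x 0 j ^+ 2 -> 0 < x 0 i * y 0 i) ->
  (x 0 i ^+ 2 - x 0 j ^+ 2 < 0 -> x 0 j * y 0 j < 0) ->
  cut_ball i j s x -> cut_ball i j (- s) y.
Proof.
move=> s1 yy Q pos neg [x1 x2 x3].
have yi := sqr_ge0 (y 0 i); have yj := sqr_ge0 (y 0 j).
split; rewrite ?yy //.
- case: (leP 0 (y 0 i)) => yi0; last by rewrite expr0n /=; lra.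
  have [xQ|xQ] := ltP 0 (x 0 i ^+ 2 - x 0 j ^+ 2); last by lra.
  have xi0 : 0 <= x 0 i.
    by rewrite leNgt; apply/negP => xi0; have := pos xQ; nra.
  by move: x2; rewrite (max_idPr xi0); lra.
- case: (leP 0 (- s * y 0 j)) => yj0; last by rewrite expr0n /=; lra.
  rewrite exprMn sqrrN s1 mul1r.
  have [xQ|xQ] := ltP (x 0 i ^+ 2 - x 0 j ^+ 2) 0; last by lra.
  have xj0 : 0 <= s * x 0 j.
    rewrite leNgt; apply/negP => xj0.
    have : 0 <= (- s * y 0 j) * - (s * x 0 j) by rewrite mulr_ge0 // oppr_ge0 ltW.
    have -> : (- s * y 0 j) * - (s * x 0 j) = s ^+ 2 * (x 0 j * y 0 j) by ring.
    by rewrite s1 mul1r leNgt neg.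
  by move: x3; rewrite (max_idPr xj0) exprMn s1 mul1r; lra.
Qed.

(** As [phi] is an involution and [s] is free, [s = 1] and [s = - 1] give the two inclusions between
    the sections. *)
Lemma section_rotation {R : realType} {n : nat} {i j k l : 'I_n}
    {xi : 'rV[R]_n} : uniq [:: i; j; k; l] -> unit_sphere xi ->
  exists phi : 'End(subvs_of (perp xi)),
    [/\ rotation phi, forall x, phi (phi x) = x &
      forall (s : R) x, s ^+ 2 = 1 -> cut_ball i j s (vsval x) ->
        cut_ball i j (- s) (vsval (phi x))].
Proof.
move=> ijkl xi1.
have ij : i != j by case/and4P: ijkl; rewrite inE negb_or => /andP[].
have [Qge0|[v [vv vxi vij vQ vperp]]] := negative_eigenvector ij xi1.
  (* The form is nonnegative on this hyperplane, so the cut depending on [s] removes nothing and the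
     identity suffices. *)
  exists \1%VF; split; first by split; [move=> x y; rewrite !id_lfunE|exact: lfun_det1].
    by move=> x; rewrite !id_lfunE.
  move=> s x s1; rewrite id_lfunE.
  have /Qge0 Qx : dotp (vsval x) xi = 0 by apply/eqP; rewrite -mem_perp subvsP.
  apply: cut_ball_transfer => // h; last by move: h; rewrite subr_lt0 ltNge Qx.
  have := sqr_ge0 (vsval x 0 j).
  by rewrite -expr2; lra.
have [c [cc cxi ci cj]] := orthogonal_unit_vector xi ijkl.
have vc : dotp v c = 0 by rewrite dotpC vperp.
have vU : v \in perp xi by rewrite mem_perp vxi.
have cU : c \in perp xi by rewrite mem_perp cxi.
have [phi [phi_rot phiE]] := half_turn_rotation vU cU vv cc vc.
exists phi; split => //.
  move=> x; apply: val_inj; rewrite -[RHS](half_turnK v c _ vv cc vc).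
  by apply: (etrans (phiE _)); congr half_turn; exact: phiE.
move=> s x s1; rewrite phiE.
have xxi : dotp (vsval x) xi = 0 by apply/eqP; rewrite -mem_perp subvsP.
move: (vsval x) xxi => {}x xxi.
(* Since [c] vanishes in the coordinates [i], [j], the half turn acts there as [z + y v] to
   [z - y v]. *)
set y := dotp x v; pose z := x - y *: v.
have zQ : z 0 i * v 0 i = z 0 j * v 0 j.
  by apply: vQ; rewrite !dotpE ?xxi ?vxi ?vv -/y; ring.
(* The form is negative at [v] and [z] is orthogonal to [v] for it, so it is nonnegative at [z]:
   multiply by [v 0 j ^+ 2] and use [zQ]. *)
have zij : z 0 j ^+ 2 <= z 0 i ^+ 2.
  have vj0 : 0 < v 0 j ^+ 2 by apply: le_lt_trans vij; exact: sqr_ge0.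
  rewrite -(ler_pM2r vj0) -exprMn -zQ exprMn ler_wpM2l ?sqr_ge0 //.
  exact: ltW.
have xE m : x 0 m = z 0 m + y * v 0 m by rewrite !mxE; ring.
have TE m : c 0 m = 0 -> half_turn v c x 0 m = z 0 m - y * v 0 m.
  by move=> cm; rewrite !mxE cm -/y; ring.
have [|||pos neg] := @half_turn_signs R (z 0 i) (y * v 0 i) (z 0 j) (y * v 0 j).
- by rewrite mulrCA zQ mulrCA.
- by rewrite !exprMn ler_wpM2l ?sqr_ge0 // ltW.
- exact: zij.
apply: cut_ball_transfer => //; rewrite ?dotp_half_turn // !TE // !xE //.
rewrite !sqrrD !sqrrN !mulrN (_ : z 0 i * (y * v 0 i) = z 0 j * (y * v 0 j)).
  by ring.
by rewrite mulrCA zQ mulrCA.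
Qed.

Theorem theorem1p5 (R : realType) (n : nat) (n_ge4 : (4 <= n)%N) :
  exists K L : set 'rV[R]_n,
    [/\ convex_body K, convex_body L, K <> L, K <> -%R @` L &
        forall xi : 'rV[R]_n, unit_sphere xi ->
          exists phi : 'End(subvs_of (perp xi)),
            rotation phi /\
            [set vsval (phi x) | x in [set x | K (vsval x)]] =
              L `&` [set x | x \in perp xi]].
Proof.
pose o (m : nat) (h : (m < 4)%N) : 'I_n := Ordinal (leq_trans h n_ge4).
pose i := @o 0 isT; pose j := @o 1 isT; pose k := @o 2 isT; pose l := @o 3 isT.
have ijkl : uniq [:: i; j; k; l] by [].
have s1 : 1 ^+ 2 = 1 :> R by rewrite expr1n.
have sN1 : (- 1) ^+ 2 = 1 :> R by rewrite sqrrN.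
have eE (a b : 'I_n) : (delta_mx 0 a : 'rV[R]_n) 0 b = (b == a)%:R by rewrite mxE.
exists (cut_ball i j 1), (cut_ball i j (- 1)).
split; [exact: cut_ball_convex_body|exact: cut_ball_convex_body| | |].
(* [e_j] is cut off the first body, where [3 + 2 > 4], but not the second. *)
- have e : cut_ball i j (- 1) (delta_mx 0 j : 'rV[R]_n).
    rewrite /cut_ball /= dotp_delta !eE /=.
    by split; rewrite ?mulr1 ?max_l ?expr0n ?expr1n //=; lra.
  move=> KL; move: e; rewrite -KL => -[_ _].
  rewrite dotp_delta !eE /= mul1r max_r //= expr0n expr1n /=.
  by lra.
(* Both bodies lose their cap around [e_i] and keep [- e_i], so reflecting the second one restores
   [e_i]. *)
- have e : cut_ball i j (- 1) (- delta_mx 0 i : 'rV[R]_n).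
    rewrite /cut_ball /= !dotpE dotp_delta !mxE /=.
    by split; rewrite ?oppr0 ?mulr0 ?max_l ?expr0n ?sqrrN ?expr1n //=; lra.
  move=> KL; have : cut_ball i j 1 (delta_mx 0 i : 'rV[R]_n).
    by rewrite KL; exists (- delta_mx 0 i); rewrite ?opprK.
  case=> _ + _; rewrite dotp_delta !eE /= max_r //= expr0n expr1n /=.
  by lra.
- move=> xi xi1.
  have [phi [phi_rot phiK phi_cut]] := section_rotation ijkl xi1.
  exists phi; split => //; apply/seteqP; split => x /=.
    by case=> y Ky <-; split; [exact: phi_cut|exact: subvsP].
  (* The preimage of [x] is its image, [phi] being an involution. *)
  case=> Lx xU; exists (phi (vsproj (perp xi) x)) => /=.
    by rewrite -(opprK 1); apply: phi_cut => //; rewrite vsprojK.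
  by rewrite phiK vsprojK.
Qed.
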